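(* Let $X$ be a fixed finite set of $m+u$ elements ($m,u\ge 1$), and let $x_1,\dots,x_m$ be random variables obtained by sampling $m$ elements of $X$ uniformly at random without replacement. Let $\phi\colon X^m\to\mathbb{R}$ be a symmetric function such that for all $i\in[1,m]$ and all $x_1,\dots,x_m\in X$, $x'_i\in X$, $$\big|\phi(x_1,\dots,x_m)-\phi(x_1,\dots,x_{i-1},x'_i,x_{i+1},\dots,x_m)\big|\le c .$$ Then for all $\epsilon>0$, $$\Pr\big[\phi-\mathbb{E}[\phi]\ge\epsilon\big]\le\exp\Big[\frac{-2\epsilon^2}{\alpha(m,u)\,c^2}\Big],\qquad \alpha(m,u)=\frac{mu}{m+u-1/2}\cdot\frac{1}{1-1/(2\max\{m,u\})}.$$
   Context: A function $\phi\colon X^m\to\mathbb{R}$ is symmetric if its value does not depend on the order of its arguments: $\phi(x_{\sigma(1)},\dots,x_{\sigma(m)})=\phi(x_1,\dots,x_m)$ for every permutation $\sigma$ of $[1,m]$. *)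

(* Defs.v *)
From HB Require Import structures.
From Stdlib Require Import Reals.
From mathcomp Require Import all_boot all_fingroup.
Set Implicit Arguments. Unset Strict Implicit. Unset Printing Implicit Defensive.

(* A sample x_1..x_m drawn without replacement from X is an injective map
   'I_m -> X; the uniform distribution is the uniform measure on these. *)
Definition samples (X : finType) (m : nat) : {set {ffun 'I_m -> X}} :=
  [set x : {ffun 'I_m -> X} | injectiveb x].

Definition expect (X : finType) (m : nat) (phi : {ffun 'I_m -> X} -> R) : R :=
  Rdiv (\big[Rplus/(IZR Z0)]_(x in samples X m) phi x) (INR #|samples X m|).

Definition prob (X : finType) (m : nat) (E : {ffun 'I_m -> X} -> bool) : R :=
  Rdiv (INR #|[set x in samples X m | E x]|) (INR #|samples X m|).

Definition Rgeb (a b : R) : bool := if Rle_dec b a then true else false.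

Definition symmetric_fun (X : finType) (m : nat) (phi : {ffun 'I_m -> X} -> R) :=
  forall (s : 'S_m) (x : {ffun 'I_m -> X}), phi [ffun i => x (s i)] = phi x.

Definition replace_at (X : finType) (m : nat) (x : {ffun 'I_m -> X}) (i : 'I_m) (y : X)
  : {ffun 'I_m -> X} := [ffun j => if j == i then y else x j].

Definition alpha (m u : nat) : R :=
  Rmult (Rdiv (Rmult (INR m) (INR u)) (Rminus (Rplus (INR m) (INR u)) (Rinv (IZR 2)))) (Rdiv (IZR 1) (Rminus (IZR 1) (Rinv (Rmult (IZR 2) (INR (maxn m u)))))).

(* Main.v *)
(** A symmetric [phi] depends only on the set of sampled points, so the sample
    may be taken to be a uniform [m]-subset, exposed one element at a time.
    Once [k] elements of [D] remain to be drawn, with [#|D| = k + u], changing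
    the first one drawn from [a] to [b] matters only if [b] is not drawn later,
    which has probability [u / (k + u - 1)]; hence the conditional mean moves by
    at most [c * u / (k + u - 1)].  Hoeffding's lemma at each step bounds the
    moment generating function by [exp (c ^ 2 / 8 * V)], where
    [V = \sum_(u <= n < m + u) (u / n) ^ 2] is at most
    [m u / (m + u - 1/2) / (1 - 1 / (2 u))].  Applying the same bound to the
    complement of the sample exchanges [m] and [u], which gives the maximum in
    [alpha m u]; Chernoff's bound with parameter [4 eps / (alpha m u * c ^ 2)]
    concludes. *)

From Stdlib Require Import Reals Lra.
From HB Require Import structures.
From Coquelicot Require Import Coquelicot.
From mathcomp Require Import all_boot all_order all_fingroup.
From mathcomp Require Import Rstruct zify.
(* [Rstruct] also defines [Rgeb]; the one of [Defs] must shadow it. *)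
Require Import Defs.
Local Open Scope R_scope.

Local Notation "\rsum_ ( i 'in' A ) F" := (\big[Rplus/(IZR Z0)]_(i in A) F)
  (at level 36, F at level 36, i, A at level 50).

(** * Exponential inequalities for a bounded variable *)

(* [L t = t ^ 2 / 8 - ln (1 - p + p e ^ t) + p t] satisfies [L 0 = L' 0 = 0] and
   [L'' = 1 / 4 - q (1 - q) >= 0] with [q = p e ^ t / (1 - p + p e ^ t)]. *)
Lemma two_point_mgf (p h : R) : 0 <= p <= 1 -> 0 <= h ->
  (1 - p) * exp (- p * h) + p * exp ((1 - p) * h) <= exp (h ^ 2 / 8).
Proof.
move=> [p0 p1] [h0|<-]; last first.
  rewrite !Rmult_0_r (_ : 0 ^ 2 / 8 = 0); last by field.
  by rewrite exp_0; lra.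
pose D t := 1 - p + p * exp t.
have D0 t : 0 < D t.
  have := exp_pos t; rewrite /D; move=> et.
  have [pe|pn] := Req_dec p 1; first by rewrite pe; lra.
  have := Rmult_le_pos _ _ p0 (Rlt_le _ _ et); lra.
pose L t := t ^ 2 / 8 + p * t - ln (D t).
pose G t := t / 4 + p - p * exp t / D t.
have dL t : derivable_pt_lim L t (G t).
  apply/is_derive_Reals; rewrite /L /D /G; auto_derive; first exact: D0.
  by rewrite /D; field; apply: Rgt_not_eq; exact: D0.
have dG t : derivable_pt_lim G t (1 / 4 - p * (1 - p) * exp t / (D t) ^ 2).
  have Dn := Rgt_not_eq _ _ (D0 t).
  apply/is_derive_Reals; rewrite /G; rewrite /D in Dn *; auto_derive => //.
  by field.
have dG0 t : 0 <= 1 / 4 - p * (1 - p) * exp t / (D t) ^ 2.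
  have := D0 t => Dp.
  (* With [q = p * exp t / D t], this is [(1 / 2 - q) ^ 2]. *)
  have -> : 1 / 4 - p * (1 - p) * exp t / (D t) ^ 2
    = ((1 - p - p * exp t) / (2 * D t)) ^ 2.
    by have Dn := Rgt_not_eq _ _ Dp; rewrite /D in Dn *; field.
  exact: pow2_ge_0.
have G0 t : 0 < t -> 0 <= G t.
  move=> t0; have [x [e _]] := MVT_cor2 _ _ _ _ t0 (fun c _ => dG c).
  have g0 : G 0 = 0 by rewrite /G /D exp_0; field; lra.
  rewrite g0 in e; have := Rmult_le_pos _ _ (dG0 x) (Rlt_le _ _ t0); lra.
have [x [e [x0 _]]] := MVT_cor2 _ _ _ _ h0 (fun c _ => dL c).
have L0 : L 0 = 0.
  by rewrite /L /D exp_0 (_ : 1 - p + p * 1 = 1); [rewrite ln_1; field | ring].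
have Lh : 0 <= L h.
  by have := Rmult_le_pos _ _ (G0 _ x0) (Rlt_le _ _ h0); lra.
have -> : (1 - p) * exp (- p * h) + p * exp ((1 - p) * h) = exp (ln (D h) - p * h).
  rewrite exp_plus exp_ln // /D.
  rewrite (_ : (1 - p) * h = h + - (p * h)); last by ring.
  by rewrite exp_plus (_ : - p * h = - (p * h)); ring.
have {e L0 x0} [l|<-] : ln (D h) - p * h <= h ^ 2 / 8 by rewrite /L in Lh; lra.
  by left; apply: exp_increasing.
by right.
Qed.

Lemma exp_le_compat x y : x <= y -> exp x <= exp y.
Proof. by move=> [l|->]; [left; apply: exp_increasing | right]. Qed.

(** Convexity of [exp]: its tangent at [y] lies below it at [lo] and at [lo + d], and the weighted
    average of these two tangent values is [exp y]. *)
Lemma exp_chord (lo d y : R) : 0 < d -> lo <= y <= lo + d ->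
  exp y <= (lo + d - y) / d * exp lo + (y - lo) / d * exp (lo + d).
Proof.
move=> d0 [ly yh].
have T x : exp y * (1 + (x - y)) <= exp x.
  rewrite -{2}(Rplus_minus y x) exp_plus.
  by apply: Rmult_le_compat_l; [left; apply: exp_pos | apply: exp_ineq1_le].
have a0 : 0 <= (lo + d - y) / d by apply: Rdiv_le_0_compat; lra.
have b0 : 0 <= (y - lo) / d by apply: Rdiv_le_0_compat; lra.
have := Rmult_le_compat_l _ _ _ a0 (T lo).
have := Rmult_le_compat_l _ _ _ b0 (T (lo + d)).
have : exp y = (lo + d - y) / d * (exp y * (1 + (lo - y)))
             + (y - lo) / d * (exp y * (1 + (lo + d - y))) by field; lra.
lra.
Qed.

(** * Averages over a finite set and Hoeffding's lemma *)

Definition mean {I : finType} (A : {set I}) (F : I -> R) : R :=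
  Rdiv (\rsum_(i in A) F i) (INR #|A|).

Section Mean.
Context {I : finType}.
Implicit Types (A : {set I}) (F G : I -> R).

Lemma rsum_le A F G : (forall i, i \in A -> F i <= G i) ->
  \rsum_(i in A) F i <= \rsum_(i in A) G i.
Proof.
move=> FG; apply: (big_ind2 Rle) => //; first exact: Rle_refl.
by move=> *; apply: Rplus_le_compat.
Qed.

Lemma rsum_const A x : \rsum_(i in A) x = INR #|A| * x.
Proof.
rewrite big_const; elim: #|A| => [|n IH]; first by rewrite /= Rmult_0_l.
by rewrite iterS IH S_INR; ring.
Qed.

Lemma card_INR_gt0 A : A != set0 -> 0 < INR #|A|.
Proof. by rewrite -card_gt0 => /ltP; apply: lt_0_INR. Qed.

Lemma eq_mean A F G : {in A, F =1 G} -> mean A F = mean A G.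
Proof. by move=> FG; rewrite /mean (eq_bigr G). Qed.

Lemma mean_le A F G : (forall i, i \in A -> F i <= G i) ->
  mean A F <= mean A G.
Proof.
move=> FG; rewrite /mean /Rdiv; case: (eqVneq A set0) => [->|A0].
  by rewrite !big_set0; right.
apply: Rmult_le_compat_r; last exact: rsum_le.
by left; apply/Rinv_0_lt_compat/card_INR_gt0.
Qed.

Lemma mean_const A x : A != set0 -> mean A (fun=> x) = x.
Proof. by move/card_INR_gt0=> A0; rewrite /mean rsum_const; field; lra. Qed.

Lemma meanD A F G : mean A (fun i => F i + G i) = mean A F + mean A G.
Proof. by rewrite /mean big_split /=; rewrite /Rdiv Rmult_plus_distr_r. Qed.

Lemma meanZ A F x : mean A (fun i => x * F i) = x * mean A F.
Proof. by rewrite /mean -big_distrr /= /Rdiv Rmult_assoc. Qed.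

Lemma mean_min A F : A != set0 -> exists2 i, i \in A & forall j, j \in A -> F i <= F j.
Proof.
case/set0Pn=> i0 Ai0.
case: (@Order.TotalTheory.arg_minP _ R I i0 (mem A) F Ai0) => i Ai Fi.
by exists i => // j /Fi /RleP.
Qed.

(** The chord bound is affine in [F i], so its mean depends only on [mean A F]. What remains is the
    law on the two endpoints with that mean, which [two_point_mgf] covers. *)
Lemma hoeffding_mgf A F d : A != set0 -> 0 < d ->
  (forall i j, i \in A -> j \in A -> F i - F j <= d) ->
  mean A (fun i => exp (F i)) <= exp (mean A F + d ^ 2 / 8).
Proof.
move=> A0 d0 Fd; have [i0 Ai0 lo] := mean_min A F A0.
have hi i : i \in A -> F i <= F i0 + d by move=> Ai; have := Fd _ _ Ai Ai0; lra.
move: (F i0) lo hi => l lo hi; set M := mean A F.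
have Ml : l <= M by rewrite -(mean_const A l A0); apply: mean_le.
have Mh : M <= l + d.
  by rewrite -(mean_const A (l + d) A0); exact: mean_le.
pose s := (exp (l + d) - exp l) / d.
apply: (Rle_trans _ (mean A (fun i => s * F i + (exp l - s * l)))).
  apply: mean_le => i Ai.
  have Fi : l <= F i <= l + d by split; [exact: lo | exact: hi].
  apply: Rle_trans (exp_chord _ _ _ d0 Fi) _.
  by right; rewrite /s; field; lra.
rewrite meanD meanZ mean_const // -/M.
(* The mass at the upper endpoint [l + d] of the two-point law with mean [M]. *)
pose p := (M - l) / d.
have pd : M = l + p * d by rewrite /p; field; lra.
have p01 : 0 <= p <= 1.
  split; first by apply: Rdiv_le_0_compat; lra.
  by apply: (Rmult_le_reg_r d) => //; lra.
have := two_point_mgf p d p01 (Rlt_le _ _ d0) => /(Rmult_le_compat_l (exp M)).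
move=> /(_ (Rlt_le _ _ (exp_pos _))); rewrite -exp_plus => H.
apply: Rle_trans H; right.
rewrite Rmult_plus_distr_l.
have e x y z : exp x * (y * exp z) = y * exp (x + z) by rewrite exp_plus; ring.
rewrite !e (_ : M + - p * d = l); last by lra.
rewrite (_ : M + (1 - p) * d = l + d); last by lra.
by rewrite /s; clearbody p; rewrite pd; field; lra.
Qed.
End Mean.

(** * Uniform [k]-subsets, drawn one element at a time *)

Definition ksub {T : finType} (D : {set T}) (k : nat) : {set {set T}} :=
  [set A : {set T} | A \subset D & #|A| == k].

Section Subsets.
Context {T : finType}.
Implicit Types (D A B : {set T}) (F G : {set T} -> R).

Lemma ksub_neq0 D k : (k <= #|D|)%N -> ksub D k != set0.
Proof. by move=> kD; rewrite -card_gt0 cards_draws bin_gt0. Qed.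

Lemma rsum_ksub_setU1 D k a F : a \in D ->
  \rsum_(B in ksub (D :\ a) k) F (a |: B)
  = \big[Rplus/0]_(A in ksub D k.+1 | a \in A) F A.
Proof.
move=> Da.
rewrite [RHS](reindex_onto (fun B => a |: B) (fun A => A :\ a)) /=; last first.
  by move=> A /andP[_ aA]; rewrite setD1K.
apply: eq_bigl => B; rewrite !inE subsetD1 eqxx andbT subUset sub1set Da /=.
case aB: (a \in B).
  rewrite andbF /= [_ && (_ == B)](_ : _ = false) //; apply/negP => /andP[_ /eqP e].
  by move: aB; rewrite -e !inE eqxx.
by rewrite setU1K ?aB // cardsU1 aB eqSS eqxx !andbT.
Qed.

(** Double counting: each [k.+1]-subset [A] arises once from each of its [k.+1] elements [a] drawn
    first. *)
Lemma mean_ksubS D k F : (k < #|D|)%N ->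
  mean (ksub D k.+1) F
  = mean D (fun a => mean (ksub (D :\ a) k) (fun B => F (a |: B))).
Proof.
move=> kD.
have cD a : a \in D -> #|D :\ a| = #|D|.-1 by move=> Da; rewrite (cardsD1 a D) Da.
transitivity (mean D (fun a => / INR 'C(#|D|.-1, k) *
    \big[Rplus/0]_(A in ksub D k.+1 | a \in A) F A)); last first.
  apply: eq_mean => a Da; rewrite /mean rsum_ksub_setU1 // cards_draws cD //.
  by rewrite /Rdiv Rmult_comm.
rewrite meanZ /mean.
have -> : \rsum_(a in D) \big[Rplus/0]_(A in ksub D k.+1 | a \in A) F A
   = INR k.+1 * \rsum_(A in ksub D k.+1) F A.
  rewrite (exchange_big_dep (fun A => A \in ksub D k.+1)); last by move=> a A /= _ /andP[].
  rewrite big_distrr; apply: eq_bigr => A; rewrite inE => /andP[AD /eqP <-].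
  rewrite -[RHS]rsum_const; apply: eq_bigl => a.
  by rewrite AD eqxx /=; apply: andb_idl => /(subsetP AD).
rewrite cards_draws.
(* With [n = #|D|], [n * C(n - 1, k) = (k + 1) * C(n, k + 1)] matches the two normalisations. *)
have := mul_bin_diag #|D| k => /(f_equal INR); rewrite !mult_INR => E.
have D0 : 0 < INR #|D| by apply: lt_0_INR; apply/ltP/(leq_ltn_trans _ kD).
have C0 : 0 < INR 'C(#|D|, k.+1) by apply: lt_0_INR; apply/ltP; rewrite bin_gt0.
have C1 : 0 < INR 'C(#|D|.-1, k).
  by apply: lt_0_INR; apply/ltP; rewrite bin_gt0 -ltnS prednK // (leq_ltn_trans _ kD).
have k0 : 0 < INR k.+1 by apply: lt_0_INR; apply/ltP.
rewrite (_ : INR #|D| = INR k.+1 * INR 'C(#|D|, k.+1) / INR 'C(#|D|.-1, k)).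
  by field; lra.
by rewrite -E; field; lra.
Qed.

(** The bounded-difference condition carried over from tuples to sets: replacing a coordinate
    becomes exchanging an element. *)
Definition swap_bounded D k F c := forall B a b,
  B \subset D -> #|B|.+1 = k -> a \in D :\: B -> b \in D :\: B ->
  F (a |: B) - F (b |: B) <= c.

(* The [k]-subsets containing both [a] and [b] contribute equally to the two means. *)
Lemma mean_ksub_setU1_diff D k u F c a b : #|D| = (k + u).+1 -> (0 < u)%N ->
  0 <= c -> swap_bounded D k.+1 F c -> a \in D -> b \in D ->
  mean (ksub (D :\ a) k) (fun B => F (a |: B))
  - mean (ksub (D :\ b) k) (fun B => F (b |: B)) <= c * INR u / INR (k + u).
Proof.
move=> cD u0 c0 Fc Da Db.
have n0 : 0 < INR (k + u) by apply: lt_0_INR; apply/ltP; rewrite addn_gt0 u0 orbT.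
have [->|ab] := eqVneq a b.
  rewrite Rminus_diag; apply: Rdiv_le_0_compat => //.
  by apply: Rmult_le_pos => //; apply: pos_INR.
have cDx x : x \in D -> #|D :\ x| = (k + u)%N.
  by move=> Dx; move: cD; rewrite (cardsD1 x D) Dx => -[].
have split_sum x y : x \in D -> y \in D -> x != y ->
    \rsum_(B in ksub (D :\ x) k) F (x |: B)
    = \big[Rplus/0]_(A in ksub D k.+1 | (x \in A) && (y \in A)) F A
      + \rsum_(B in ksub (D :\ x :\ y) k) F (x |: B).
  move=> Dx Dy xy; rewrite rsum_ksub_setU1 // (bigID (fun A => y \in A)) /=.
  congr (_ + _); first by apply: eq_bigl => A; rewrite andbA.
  rewrite setDDl setUC -setDDl rsum_ksub_setU1; last by rewrite !inE xy.
  by apply: eq_bigl => A; rewrite !inE subsetD1; case: (_ \in A); case: (_ \in A);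
     rewrite ?andbF ?andbT.
rewrite /mean !cards_draws !cDx // (split_sum a b) // (split_sum b a) //; last by rewrite eq_sym.
rewrite (_ : \big[Rplus/0]_(A in ksub D k.+1 | (b \in A) && (a \in A)) F A
  = \big[Rplus/0]_(A in ksub D k.+1 | (a \in A) && (b \in A)) F A); last first.
  by apply: eq_bigl => A; rewrite [(b \in A) && _]andbC.
rewrite (_ : D :\ b :\ a = D :\ a :\ b); last by rewrite setDDl setUC -setDDl.
set K := ksub (D :\ a :\ b) k.
have le_K : \rsum_(B in K) F (a |: B) <= \rsum_(B in K) F (b |: B) + c * INR #|K|.
  rewrite Rmult_comm -rsum_const -big_split; apply: rsum_le => B.
  rewrite inE !subsetD1 => /andP[/andP[/andP[BD aB] bB] /eqP cB] /=.
  by have := Fc B a b BD (congr1 succn cB); rewrite !inE aB bB Da Db => /(_ isT isT); lra.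
(* The subsets in [K] avoid both points; they are a fraction [u / (k + u)] of the [k]-subsets of
   [D :\ a], whence the factor in the bound. *)
have cK : INR (k + u) * INR #|K| = INR u * INR 'C(k + u, k).
  rewrite /K cards_draws (_ : #|D :\ a :\ b| = (k + u).-1); last first.
    by have := cDx a Da; rewrite (cardsD1 b (D :\ a)) !inE eq_sym ab Db => <-.
  by rewrite -!mult_INR -[Init.Nat.mul _ _]/(muln _ _) mul_bin_down addKn.
have C0 : 0 < INR 'C(k + u, k) by apply: lt_0_INR; apply/ltP; rewrite bin_gt0 leq_addr.
have -> : c * INR u / INR (k + u) = c * INR #|K| / INR 'C(k + u, k).
  have -> : INR #|K| = INR u * INR 'C(k + u, k) / INR (k + u) by rewrite -cK; field; lra.
  by field; lra.
rewrite /Rdiv -Rmult_minus_distr_r; apply: Rmult_le_compat_r; last by lra.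
by left; apply: Rinv_0_lt_compat.
Qed.

(* Upper bound for [\sum_(u <= n < k + u) (u / n) ^ 2]: replacing [n ^ 2] by
   [n ^ 2 - 1 / 4] makes the sum telescope. *)
Definition variance_factor (k u : nat) : R :=
  INR u ^ 2 * (/ (INR u - / 2) - / (INR (k + u) - / 2)).

Lemma variance_factorS k u : (0 < u)%N ->
  (INR u / INR (k + u)) ^ 2 + variance_factor k u <= variance_factor k.+1 u.
Proof.
move=> u0; rewrite /variance_factor addSn S_INR.
have n1 : 1 <= INR (k + u) by apply: (le_INR 1); apply/leP; rewrite addn_gt0 u0 orbT.
move: (INR (k + u)) n1 => n n1.
have h : / n ^ 2 <= / (n - / 2) - / (n + 1 - / 2).
  rewrite (_ : / (n - / 2) - _ = / (n ^ 2 - / 4)); last by field; nra.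
  by apply: Rinv_le_contravar; nra.
have := Rmult_le_compat_l _ _ _ (pow2_ge_0 (INR u)) h.
rewrite (_ : (INR u / n) ^ 2 = INR u ^ 2 * / n ^ 2); last by field; lra.
by rewrite !Rmult_minus_distr_l; lra.
Qed.

Lemma mean_ksub0 D F : mean (ksub D 0) F = F set0.
Proof.
rewrite -[RHS](mean_const (ksub D 0) _ (ksub_neq0 D 0 (leq0n _))).
by apply: eq_mean => A; rewrite inE cards_eq0 => /andP[_ /eqP->].
Qed.

(** Induction on [k] with [u] fixed: once [a] is drawn, [D :\ a] has [k + u] elements, so the
    induction hypothesis bounds every inner mean with the same constant. Hoeffding's lemma for the
    outer mean over [a] adds the term [(u / (k + u)) ^ 2]. *)
Lemma mgf_ksub k u D F c : #|D| = (k + u)%N -> (0 < u)%N -> 0 < c ->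
  swap_bounded D k F c ->
  mean (ksub D k) (fun A => exp (F A))
  <= exp (mean (ksub D k) F + c ^ 2 / 8 * variance_factor k u).
Proof.
move=> + u0 c0; elim: k D F => [|k IH] D F cD Fc.
  (* Nothing is drawn: [variance_factor 0 u] vanishes and both sides are [exp (F set0)]. *)
  rewrite !mean_ksub0 /variance_factor add0n Rminus_diag !Rmult_0_r Rplus_0_r.
  exact: Rle_refl.
have D0 : D != set0 by rewrite -card_gt0 cD.
rewrite !mean_ksubS ?cD ?leq_addr //.
set M := fun a => mean (ksub (D :\ a) k) (fun B => F (a |: B)).
set K := c ^ 2 / 8 * variance_factor k u.
apply: (Rle_trans _ (mean D (fun a => exp (M a + K)))).
  apply: mean_le => a Da; apply: IH.
    by move: cD; rewrite (cardsD1 a D) Da => -[].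
  (* The swap bound is inherited by adjoining [a] to the common part [B]. *)
  move=> B x y; rewrite subsetD1 => /andP[BD aB] cB.
  rewrite !in_setD !in_set1 => /and3P[xB xa xD] /and3P[yB ya yD].
  rewrite !(setUCA [set a]); apply: Fc; rewrite ?subUset ?sub1set ?Da //.
  - by rewrite cardsU1 aB add1n cB.
  - by rewrite !inE (negbTE xa) (negbTE xB).
  - by rewrite !inE (negbTE ya) (negbTE yB).
have n0 : 0 < INR (k + u) by apply: lt_0_INR; apply/ltP; rewrite addn_gt0 u0 orbT.
have d0 : 0 < c * INR u / INR (k + u).
  by apply: Rdiv_lt_0_compat => //; apply: Rmult_lt_0_compat => //; apply: lt_0_INR; apply/ltP.
apply: Rle_trans (hoeffding_mgf _ _ _ D0 d0 _) _.
  move=> a b Da Db.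
  by have := mean_ksub_setU1_diff _ _ _ _ _ _ _ cD u0 (Rlt_le _ _ c0) Fc Da Db;
     rewrite -/(M a) -/(M b); lra.
apply: exp_le_compat; rewrite meanD mean_const // Rplus_assoc.
apply: Rplus_le_compat_l; rewrite /K.
have c2 : 0 <= c ^ 2 / 8 by have := pow2_ge_0 c; lra.
have := Rmult_le_compat_l _ _ _ c2 (variance_factorS k u u0).
rewrite Rmult_plus_distr_l.
rewrite (_ : (c * INR u / INR (k + u)) ^ 2 / 8 = c ^ 2 / 8 * (INR u / INR (k + u)) ^ 2).
  by lra.
by field; lra.
Qed.

(** * Passing to complements *)

Lemma mean_ksubC k u F : #|T| = (k + u)%N ->
  mean (ksub setT u) (fun A => F (~: A)) = mean (ksub setT k) F.
Proof.
move=> cT; rewrite /mean !cards_draws cardsT cT.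
rewrite -(bin_sub (leq_addl k u)) addnK; congr (_ / _).
rewrite [RHS](reindex_inj (@setC_inj T)); apply: eq_bigl => A.
rewrite !inE !subsetT -(eqn_add2l #|A| #|~: A|) cardsC cT /=.
by rewrite [(#|A| + k)%N]addnC eqn_add2l eq_sym.
Qed.

(** Trading [a] for [b] in a set trades [b] for [a] in its complement, where the common part is the
    complement of [a |: (b |: B)]. *)
Lemma swap_boundedC k u F c : #|T| = (k + u)%N -> 0 <= c ->
  swap_bounded setT k F c -> swap_bounded setT u (fun A => F (~: A)) c.
Proof.
move=> cT c0 Fc B a b _ cB; rewrite !inE !andbT => aB bB.
have [->|ab] := eqVneq a b; first by rewrite Rminus_diag.
have setE x y : x != y -> y \notin B -> ~: (x |: B) = y |: ~: (x |: (y |: B)).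
  move=> xy yB; apply/setP => z; rewrite !inE.
  by have [->|] := eqVneq z y; rewrite ?(negbTE yB) ?orbF // eq_sym.
rewrite (setE a b) // (setE b a) 1?eq_sym // (setUCA [set b]).
apply: Fc; rewrite ?subsetT ?inE ?eqxx ?orbT //.
have := cardsC (a |: (b |: B)); rewrite !cardsU1 !inE (negbTE ab) (negbTE aB) bB cT -cB /=.
lia.
Qed.

End Subsets.

(** * From injective samples to subsets *)

Section Samples.
Context {X : finType} {m : nat}.
Implicit Types (x y : {ffun 'I_m -> X}) (A : {set X}) (phi : {ffun 'I_m -> X} -> R).

Lemma card_samples_imset A : #|A| = m ->
  #|[set x in samples X m | x @: setT == A]| = m`!.
Proof.
move=> cA; rewrite -ffactnn.
have := @card_inj_ffuns_on 'I_m X (mem A); rewrite card_ord cA => <-.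
apply: eq_card => x; rewrite !inE andbC; case: injectiveP => [xI|]; rewrite ?andbF // !andbT.
apply/eqP/ffun_onP => [<- i|xA]; first by rewrite imset_f.
apply/eqP; rewrite eqEcard card_imset // cardsT card_ord cA leqnn andbT.
by apply/subsetP => _ /imsetP[i _ ->]; apply: xA.
Qed.

(** The image of a uniform sample is a uniform [m]-subset, since all fibres of the image map have
    the same size. *)
Lemma mean_samples_imset (F : {set X} -> R) : (m <= #|X|)%N ->
  mean (samples X m) (fun x => F (x @: setT)) = mean (ksub setT m) F.
Proof.
move=> mX.
have cS : #|samples X m| = ('C(#|X|, m) * m`!)%N.
  rewrite bin_ffact; have := @card_inj_ffuns 'I_m X; rewrite card_ord => <-.
  by apply: eq_card => x; rewrite !inE.
rewrite /mean cS cards_draws cardsT.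
rewrite (partition_big (fun x : {ffun 'I_m -> X} => x @: setT) (fun A => A \in ksub setT m)) /=;
  last first.
  by move=> x; rewrite !inE subsetT => /injectiveP xI; rewrite card_imset // cardsT card_ord eqxx.
have -> : \rsum_(A in ksub setT m)
    \big[Rplus/0]_(x in samples X m | x @: setT == A) F (x @: setT)
  = INR m`! * \rsum_(A in ksub setT m) F A.
  rewrite big_distrr; apply: eq_bigr => A; rewrite inE => /andP[_ /eqP cA] /=.
  rewrite -(card_samples_imset _ cA) -rsum_const.
  by apply: eq_big => x; [rewrite [RHS]inE | case/andP=> _ /eqP->].
have C0 : 0 < INR 'C(#|X|, m) by apply: lt_0_INR; apply/ltP; rewrite bin_gt0.
have f0 : 0 < INR m`! by apply: lt_0_INR; apply/ltP; exact: fact_gt0.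
rewrite mult_INR; set S := (X in _ * X / _ = _); rewrite -[X in _ = X / _]/S.
by field; split; apply: Rgt_not_eq.
Qed.

(** Both samples list the same set without repetition, so they differ by a permutation of the
    indices. *)
Lemma symmetric_fun_imset phi x y : symmetric_fun phi ->
  x \in samples X m -> y \in samples X m -> x @: setT = y @: setT -> phi x = phi y.
Proof.
rewrite !inE => sym /injectiveP xI /injectiveP yI xy.
have /tuple_permP[s xs] : perm_eq (mktuple x) (mktuple y).
  apply: uniq_perm; rewrite ?map_inj_uniq -?enumT ?enum_uniq // => z.
  have memE (f : {ffun 'I_m -> X}) : (z \in mktuple f) = (z \in f @: setT).
    apply/mapP/imsetP => -[i _ ->]; first by exists i; rewrite ?inE.
    by exists i; rewrite ?mem_enum.
  by rewrite !memE xy.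
rewrite -(sym s y); congr (phi _); apply/ffunP => i; rewrite ffunE.
have := congr1 (fun t => tnth t i) (val_inj xs : mktuple x = mktuple _).
by rewrite !tnth_mktuple.
Qed.

Lemma ex_sample A : #|A| = m -> exists2 x, x \in samples X m & x @: setT = A.
Proof.
move=> cA; have : [set x in samples X m | x @: setT == A] != set0.
  by rewrite -card_gt0 card_samples_imset ?fact_gt0.
by case/set0Pn=> x; rewrite inE => /andP[xS /eqP xA]; exists x.
Qed.

Lemma replace_at_sample x i b : x \in samples X m -> b \notin x @: setT ->
  replace_at x i b \in samples X m
  /\ replace_at x i b @: setT = b |: (x @: setT :\ x i).
Proof.
rewrite !inE => /injectiveP xI bx.
have xb j : (x j == b) = false by apply: contraNF bx => /eqP <-; rewrite imset_f.
have rI : injective (replace_at x i b).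
  move=> j k; rewrite !ffunE.
  case: eqP => [->|_]; case: eqP => [->|_] // /eqP; rewrite ?[b == _]eq_sym ?xb //.
  by move=> /eqP /xI.
split; first exact/injectiveP.
apply/eqP; rewrite eqEcard card_imset // cardsU1 cardsT card_ord.
rewrite !inE (negbTE bx) andbF /=.
have := cardsD1 (x i) (x @: setT).
rewrite imset_f // card_imset // cardsT card_ord => <-; rewrite leqnn andbT.
apply/subsetP => _ /imsetP[j _ ->]; rewrite ffunE !inE.
case: (eqVneq j i) => [_|ji]; first by rewrite eqxx.
by rewrite imset_f // andbT (inj_eq xI) ji orbT.
Qed.

(** The function that a symmetric [phi] induces on [m]-subsets, read off an arbitrary enumeration; 0
    is returned only when no sample has image [A]. *)
Definition set_fun phi A : R :=
  if [pick x in samples X m | x @: setT == A] is Some x then phi x else 0.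

Lemma set_fun_imset phi x : symmetric_fun phi -> x \in samples X m ->
  set_fun phi (x @: setT) = phi x.
Proof.
move=> sym xS; rewrite /set_fun; case: pickP => [y /andP[yS /eqP e]|/(_ x)].
  exact: symmetric_fun_imset.
by rewrite xS eqxx.
Qed.

Lemma swap_bounded_set_fun phi c : symmetric_fun phi ->
  (forall i x (b : X), Rabs (phi x - phi (replace_at x i b)) <= c) -> 0 <= c ->
  swap_bounded setT m (set_fun phi) c.
Proof.
move=> sym bd c0 B a b _ cB; rewrite !inE !andbT => aB bB.
have [->|ab] := eqVneq a b; first by rewrite Rminus_diag.
(* Enumerate [a |: B] by a sample; putting [b] at the coordinate that holds [a] then enumerates
   [b |: B]. *)
have [x xS xA] : exists2 x, x \in samples X m & x @: setT = a |: B.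
  by apply: ex_sample; rewrite cardsU1 aB add1n.
have /imsetP[i _ ai] : a \in x @: setT by rewrite xA setU11.
have bx : b \notin x @: setT by rewrite xA !inE eq_sym (negbTE ab).
have [rS rA] := replace_at_sample x i b xS bx.
rewrite -ai xA setU1K // in rA.
rewrite -xA -rA !set_fun_imset //.
exact: Rle_trans (Rle_abs _) (bd i x b).
Qed.

End Samples.

(** * The constant [alpha] and Chernoff's bound *)

Lemma alphaE m u : (1 <= m)%N -> (1 <= u)%N ->
  alpha m u = if (m <= u)%N then variance_factor m u else variance_factor u m.
Proof.
move=> /leP/(le_INR 1) /= m1 /leP/(le_INR 1) /= u1.
rewrite /alpha /variance_factor [(u + m)%N]addnC plus_INR.
by case: leqP => mu; field; lra.
Qed.

Lemma alpha_gt0 m u : (1 <= m)%N -> (1 <= u)%N -> 0 < alpha m u.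
Proof.
move=> m1 u1; have : (1 <= maxn m u)%N by rewrite leq_max m1.
move: m1 u1 => /leP/(le_INR 1) /= m1 /leP/(le_INR 1) /= u1 /leP/(le_INR 1) /= M1.
rewrite /alpha; move: (INR (maxn m u)) M1 => M M1.
have h : / (2 * M) <= / 2 by apply: Rinv_le_contravar; lra.
apply: Rmult_lt_0_compat; apply: Rdiv_lt_0_compat; try lra.
by apply: Rmult_lt_0_compat; lra.
Qed.

(** The smaller of the sample and its complement is exposed, so that [maxn m u] plays the part of
    [u] in [mgf_ksub]. *)
Lemma mgf_samples (X : finType) (m u : nat) (phi : {ffun 'I_m -> X} -> R) c :
  (1 <= m)%N -> (1 <= u)%N -> #|X| = (m + u)%N -> symmetric_fun phi ->
  (forall i x y, Rabs (phi x - phi (replace_at x i y)) <= c) -> 0 < c ->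
  mean (samples X m) (fun x => exp (phi x))
  <= exp (mean (samples X m) phi + c ^ 2 / 8 * alpha m u).
Proof.
move=> m1 u1 cX sym bd c0.
have mX : (m <= #|X|)%N by rewrite cX leq_addr.
pose F := set_fun phi.
rewrite (eq_mean _ phi (fun x => F (x @: setT))); last by move=> x xS; rewrite /F set_fun_imset.
rewrite (eq_mean _ (fun x => exp (phi x)) (fun x => exp (F (x @: setT)))); last first.
  by move=> x xS; rewrite /F set_fun_imset.
rewrite mean_samples_imset // (mean_samples_imset (fun A => exp (F A))) // alphaE //.
have Fc : swap_bounded setT m F c by apply: swap_bounded_set_fun => //; lra.
case: leqP => mu; first by apply: mgf_ksub => //; rewrite cardsT.
rewrite -!(mean_ksubC _ _ _ cX).
apply: (mgf_ksub u m setT (fun A => F (~: A))) => //; first by rewrite cardsT cX addnC.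
by apply: (swap_boundedC _ _ _ _ cX) => //; lra.
Qed.

Theorem theorem5 (X : finType) (m u : nat) (hm : (1 <= m)%N) (hu : (1 <= u)%N)
  (hX : #|X| = (m + u)%N)
  (phi : {ffun 'I_m -> X} -> R) (c : R)
  (hsym : symmetric_fun phi)
  (hbd : forall (i : 'I_m) (x : {ffun 'I_m -> X}) (y : X),
           Rabs (phi x - phi (replace_at x i y)) <= c)
  (eps : R) (heps : 0 < eps) :
  prob (fun x => Rgeb (phi x - expect phi) eps)
     <= exp (- 2 * eps ^ 2 / (alpha m u * c ^ 2)).
Proof.
have mX : (m <= #|X|)%N by rewrite hX leq_addr.
have S0 : samples X m != set0.
  have /set0Pn[A] : ksub [set: X] m != set0 by rewrite ksub_neq0 ?cardsT.
  by rewrite inE => /andP[_ /eqP /ex_sample[x xS _]]; apply/set0Pn; exists x.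
pose E x := Rgeb (phi x - expect phi) eps.
have -> : prob E = mean (samples X m) (fun x => if E x then 1 else 0).
  rewrite /prob /mean -big_mkcondr /=; congr (_ / _).
  rewrite -[LHS]Rmult_1_r -rsum_const.
  by apply: eq_bigl => x; rewrite inE.
have [x0 _] := set0Pn _ S0.
have c0 : 0 <= c by exact: Rle_trans (Rabs_pos _) (hbd (Ordinal hm) x0 (x0 (Ordinal hm))).
case: c0 => [c0|c0]; last first.
  (* Here the right-hand side is [exp (_ / 0) = exp 0]. *)
  rewrite -c0 (_ : alpha m u * 0 ^ 2 = 0); last by ring.
  rewrite /Rdiv Rinv_0 Rmult_0_r exp_0 -{2}(mean_const _ 1 S0).
  by apply: mean_le => x _; case: (E x); lra.
have a0 := alpha_gt0 m u hm hu.
(* The minimiser of [- l * eps + l ^ 2 * c ^ 2 * alpha m u / 8], whose minimum is the exponent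
   claimed. *)
pose l := 4 * eps / (alpha m u * c ^ 2).
have c20 : 0 < c ^ 2 by apply: pow_lt.
have l0 : 0 < l.
  by apply: Rdiv_lt_0_compat; [lra | apply: Rmult_lt_0_compat].
pose t := - l * (expect phi + eps).
(* Markov's inequality: the indicator is at most [exp (l * (phi x - expect phi - eps))], whose
   exponent is nonnegative on the event. *)
apply: (Rle_trans _ (mean (samples X m) (fun x => exp t * exp (l * phi x)))).
  apply: mean_le => x _; rewrite -exp_plus /E /Rgeb.
  case: Rle_dec => h /=; last by left; apply: exp_pos.
  rewrite -exp_0; apply: exp_le_compat.
  have := Rmult_le_compat_l _ _ _ (Rlt_le _ _ l0) h; rewrite /t; lra.
rewrite meanZ.
have lsym : symmetric_fun (fun x => l * phi x) by move=> s x; rewrite hsym.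
have lbd i x y : Rabs (l * phi x - l * phi (replace_at x i y)) <= l * c.
  rewrite -Rmult_minus_distr_l Rabs_mult Rabs_pos_eq; last by lra.
  by apply: Rmult_le_compat_l; [lra | exact: hbd].
have := mgf_samples X m u _ (l * c) hm hu hX lsym lbd (Rmult_lt_0_compat _ _ l0 c0).
move/(Rmult_le_compat_l _ _ _ (Rlt_le _ _ (exp_pos t)))=> H; apply: Rle_trans H _.
rewrite -exp_plus meanZ; apply: exp_le_compat; right.
by rewrite /t /l -[mean _ _]/(expect phi); field; lra.
Qed.
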